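(* If $g(\cdot)$ is a Borel ($\mathcal B$-measurable, real-valued) function on $J$, then for every $t\ge0$ $$\sum_{u\in N_t}g(X_u(t))\,e^{-\int_0^t m(X_u(s))R(X_u(s))\,ds}\,\zeta_u(t)=\tilde{\mathbb Q}\big(g(\xi_t)\,\big|\,\mathcal F_t\big)\times Z(t).$$
   Context: **Branching Markov process.** Let $(J,\mathcal B)$ be a measurable space, $\Xi=(\Xi_t)_{t\ge 0}$ a Markov process in $J$, $R:J\to[0,\infty)$ a measurable function, and for each $x\in J$ let $A(x)$ be a random variable in $\{0,1,2,\dots\}$ with $P(A(x)=k)=p_k(x)$ and finite mean $m(x)=\sum_k k\,p_k(x)$. In the branching Markov process each particle $u$ moves in $J$ as an independent copy of $\Xi$ started from its birth position; if alive at time $t$ at position $X_u(t)$ it dies in $[t,t+dt)$ with probability $R(X_u(t))\,dt+o(dt)$; on dying at location $y$ it is replaced by $1+A_u$ particles positioned at $y$, where $A_u$ is an independent copy of $A(y)$; once born, particles evolve independently. **Marked trees with spines.** Let $\Omega=\{\emptyset\}\cup\bigcup_{n\ge1}\mathbb N^n$, $\mathbb N=\{1,2,\dots\}$, be the set of finite words, with concatenation $uv$; $v<u$ means that $v$ is a strict ancestor of $u$ (i.e. $u=vw$ with $w\ne\emptyset$), and $v\le u$ means $v<u$ or $v=u$. A Galton-Watson tree is a set $\tau\subset\Omega$ with $\emptyset\in\tau$; $uv\in\tau\Rightarrow u\in\tau$; and for each $u\in\tau$ there is $A_u\in\{0,1,2,\dots\}$ with $uj\in\tau\iff 1\le j\le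 1+A_u$. A marked tree $(\tau,M)=(\tau,X,\sigma)$ assigns to each $u\in\tau$ a lifetime $\sigma_u\in\mathbb R^+$ and a path $X_u:[S_u-\sigma_u,S_u)\to J$, where $S_u=\sum_{v\le u}\sigma_v$ is the death (fission) time; at time $S_u$ the particle $u$ has disappeared and its children are alive. The path is extended to $[0,S_u)$ by $X_u(t)=X_v(t)$ for the ancestor $v<u$ with $S_v-\sigma_v\le t<S_v$. $N_t=\{u\in\tau:S_u-\sigma_u\le t<S_u\}$ is the set of particles alive at time $t$. A spine $\xi\in\partial\tau$ is an infinite line of descent $\{\emptyset,u_1,u_2,\dots\}$ in $\tau$. $\tilde{\mathcal T}$ is the set of all $(\tau,M,\xi)$ with $(\tau,M)$ a marked tree and $\xi\in\partial\tau$. There is no explosion: for every $t\ge 0$ each line of descent has exactly one node alive at time $t$; for the spine this node is $\mathrm{node}_t(\xi)$. The symbol $\xi_t$ denotes, according to context, either this node (as in $\{\xi_t=u\}$, $v<\xi_t$) or its spatial position $X_{\mathrm{node}_t(\xi)}(t)\in J$ (as in $g(\xi_t)$, $R(\xi_s)$). **Filtrations on $\tilde{\mathcal T}$.** $\mathcal F_t=\sigma\big((u,X_u,\sigma_u):S_u\le t;\ (u,X_u(s):s\in[S_u-\sigma_u,t]):t\in[S_u-\sigma_u,S_u)\big)$; $\tilde{\mathcal F}_t=\sigma(\mathcal F_t,\mathrm{node}_t(\xi))$ (the branching process and the spine nodes up to time $t$); $\mathcal G_t=\sigma(\xi_s:0\le s\le t)$ (spatial positions of the spine only). $\mathcal F_\infty,\tilde{\mathcal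 F}_\infty,\mathcal G_\infty$ are generated by the respective unions over $t$. **Measures.** Fix a starting point $x\in J$; superscripts $x$ are suppressed. $P=P^x$ is the probability measure on $(\tilde{\mathcal T},\mathcal F_\infty)$ under which $\mathbb X_t=\{X_u(t):u\in N_t\}$ is the branching Markov process above started from one particle at $x$. Every $\tilde{\mathcal F}_t$-measurable $f$ can be written $f=\sum_{u\in N_t}f_u\mathbf 1_{(\xi_t=u)}$ with each $f_u$ being $\mathcal F_t$-measurable. The probability measure $\tilde P=\tilde P^x$ on $(\tilde{\mathcal T},\tilde{\mathcal F}_\infty)$ is defined by $\int f\,d\tilde P=\int\sum_{u\in N_t}f_u\prod_{v<u}\frac1{1+A_v}\,dP$ for each (nonnegative or bounded) $\tilde{\mathcal F}_t$-measurable $f$. **Martingales.** $\zeta(t)$ is a given strictly positive $\mathcal G_t$-adapted $\tilde P$-martingale, represented as $\zeta(t)=\sum_{u\in N_t}\zeta_u(t)\mathbf 1_{(\xi_t=u)}$ with $\zeta_u(t)$ $\mathcal F_t$-measurable. Define $$Z(t)=\sum_{u\in N_t}e^{-\int_0^t m(X_u(s))R(X_u(s))\,ds}\,\zeta_u(t),\qquad \tilde\zeta(t)=\prod_{v<\xi_t}(1+A_v)\;e^{-\int_0^t m(\xi_s)R(\xi_s)\,ds}\;\zeta(t).$$ The integrals in the exponents are finite, so these processes are strictly positive; $\tilde\zeta$ is an $\tilde{\mathcal F}_t$-adapted $\tilde P$-martingale. **Changed measure.** $\tilde{\mathbb Q}$ is the probability measure on $(\tilde{\mathcal T},\tilde{\mathcal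 F}_\infty)$ with $\frac{d\tilde{\mathbb Q}}{d\tilde P}\big|_{\tilde{\mathcal F}_t}=\tilde\zeta(t)/\tilde\zeta(0)$ for all $t\ge0$. $\tilde{\mathbb Q}(\cdot\mid\mathcal F_t)$ denotes conditional expectation, and equalities hold $\tilde{\mathbb Q}$-almost surely. As usual, the function whose conditional expectation is taken is understood to be nonnegative or $\tilde{\mathbb Q}$-integrable. *)

(* Defs.v *)
From HB Require Import structures.
From mathcomp Require Import all_boot all_order all_algebra.
From mathcomp Require Import all_classical all_reals all_analysis.
From mathcomp Require Import measurable_realfun.

Set Implicit Arguments.
Unset Strict Implicit.
Unset Printing Implicit Defensive.

Import Order.TTheory GRing.Theory Num.Theory.
Import numFieldNormedType.Exports.

Local Open Scope classical_set_scope.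
Local Open Scope ring_scope.

Definition meas_wrt (T : Type) (F : set (set T)) (d : measure_display)
    (U : measurableType d) (f : T -> U) : Prop :=
  forall B : set U, measurable B -> F (f @^-1` B).

(* [Y] is a version of the conditional expectation of [X] given [F]; meaningful
   when [X] is nonnegative or integrable. *)
Definition is_cond_exp (d : measure_display) (T : measurableType d)
    (R : realType) (mu : probability T R) (F : set (set T))
    (X Y : T -> \bar R) : Prop :=
  meas_wrt F Y /\
  forall A, F A ->
    (\int[mu]_(w in A) Y w = \int[mu]_(w in A) X w)%E.

Definition martingale (d : measure_display) (T : measurableType d)
    (R : realType) (mu : probability T R) (F : R -> set (set T))
    (M : R -> T -> R) : Prop :=
  [/\ forall t, 0 <= t -> meas_wrt (F t) (M t),
      forall t, 0 <= t -> mu.-integrable setT (EFin \o M t) &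
      forall s t, 0 <= s -> s <= t ->
        is_cond_exp mu (F s) (EFin \o M t) (EFin \o M s)].

(* [W] is the space of trajectories, [ev t w] the position at time [t] of the
   trajectory [w], and [Xi y] the law of the process started from [y].  Only
   times [t >= 0] matter.  Joint measurability of [ev] is what gives a meaning
   to time integrals along the trajectories. *)
Definition natural_filtration (R : realType) (dJ : measure_display)
    (J : measurableType dJ) (W : Type) (ev : R -> W -> J) (s : R) :
    set (set W) :=
  <<s [set E | exists r (B : set J),
         [/\ 0 <= r <= s, measurable B & E = ev r @^-1` B]] >>.

Definition markov_process (R : realType) (dJ dW : measure_display)
    (J : measurableType dJ) (W : measurableType dW)
    (ev : R -> W -> J) (Xi : R.-pker J ~> W) : Prop :=
  [/\ measurable_fun [set q : R * W | 0 <= q.1]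
        (fun q : R * W => ev q.1 q.2),
      forall (y : J) (B : set J), measurable B ->
        Xi y (ev 0 @^-1` B) = (\1_B y)%:E &
      forall (y : J) (s t : R) (A : set W) (B : set J),
        0 <= s -> 0 <= t -> natural_filtration ev s A -> measurable B ->
        (Xi y (A `&` ev (s + t)%R @^-1` B) =
         \int[Xi y]_(w in A) Xi (ev s w) (ev t @^-1` B))%E].

(* [p y [set k]] is the probability that [A(y) = k]. *)
Definition mean_offspring_ext (R : realType) (dJ : measure_display)
    (J : measurableType dJ) (p : R.-pker J ~> nat) (y : J) : \bar R :=
  (\sum_(0 <= k <oo) (k%:R)%:E * p y [set k])%E.

Definition mean_offspring (R : realType) (dJ : measure_display)
    (J : measurableType dJ) (p : R.-pker J ~> nat) (y : J) : R :=
  fine (mean_offspring_ext p y).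

(* Particles are finite words, the child [j] of [u] being [rcons u j]; the
   ancestors of [u], itself included, are the prefixes [take k u] with
   [k <= size u]. *)
Definition death_time (R : realType) (life : seq nat -> R) (u : seq nat) : R :=
  \sum_(k < (size u).+1) life (take k u).

Definition birth_time (R : realType) (life : seq nat -> R) (u : seq nat) : R :=
  death_time life u - life u.

(* The marks are total functions, of which only the values at [u] in [tau] and,
   for [path u], at times in [birth u, death u) are meaningful; the
   sigma-algebras below see nothing else.  Each path is a piece of a trajectory
   of the underlying motion, started at the birth time. *)
Record marked_tree (R : realType) (J W : Type) (ev : R -> W -> J) :=
  MarkedTree {
  tau : set (seq nat);
  off : seq nat -> nat;
  life : seq nat -> R;
  path : seq nat -> R -> J;
  tau_root : tau [::];
  tau_prefix : forall u v, tau (u ++ v) -> tau u;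
  tau_children : forall u j,
    tau u -> tau (rcons u j) <-> (1 <= j <= 1 + off u)%N;
  life_gt0 : forall u, tau u -> 0 < life u;
  path_trajectory : forall u, tau u -> exists w : W,
    forall s, 0 <= s < life u -> path u (birth_time life u + s) = ev s w;
  no_explosion : forall l : nat -> nat, (forall n, tau (mkseq l n)) ->
    forall t, 0 <= t -> exists! n,
      birth_time life (mkseq l n) <= t < death_time life (mkseq l n) }.

(* The spine is given by the sequence [spine] of its successive letters. *)
Record spined_tree (R : realType) (J W : Type) (ev : R -> W -> J) :=
  SpinedTree {
  mtree :> marked_tree ev;
  spine : nat -> nat;
  spine_tau : forall n, tau mtree (mkseq spine n) }.

(* A measurableType has to be pointed: take the tree with a single infinite
   line of descent and unit lifetimes. *)
Section pointed.
Variables (R : realType) (J : Type) (W : pointedType) (ev : R -> W -> J).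

Let death1 (u : seq nat) : death_time (fun=> 1 : R) u = (size u).+1%:R.
Proof. by rewrite /death_time sumr_const card_ord. Qed.

Let birth1 (u : seq nat) : birth_time (fun=> 1 : R) u = (size u)%:R.
Proof. by rewrite /birth_time death1 -natr1 addrK. Qed.

Let line : set (seq nat) := [set u | all (pred1 1%N) u].

Let line_prefix u v : line (u ++ v) -> line u.
Proof. by rewrite /line /= all_cat => /andP[]. Qed.

Let line_children u j :
  line u -> line (rcons u j) <-> (1 <= j <= 1 + (fun=> 0%N) u)%N.
Proof.
rewrite /line /= all_rcons => ->.
by rewrite andbT /= addn0 eqn_leq andbC.
Qed.

Let path1 (u : seq nat) : line u -> exists w : W,
  forall s, 0 <= s < (fun=> 1 : R) u ->
  (fun v t => ev (t - birth_time (fun=> 1 : R) v) point) u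
    (birth_time (fun=> 1 : R) u + s) = ev s w.
Proof. by move=> _; exists point => s _; rewrite addrAC subrr add0r. Qed.

Let no_explosion1 (l : nat -> nat) : (forall n, line (mkseq l n)) ->
  forall t : R, 0 <= t -> exists! n,
  birth_time (fun=> 1 : R) (mkseq l n) <= t
    < death_time (fun=> 1 : R) (mkseq l n).
Proof.
move=> _ t t0; exists (Num.trunc t); split.
  by rewrite birth1 death1 size_mkseq truncn_itv.
by move=> n; rewrite birth1 death1 size_mkseq => /truncn_def.
Qed.

Let spine1 n : line (mkseq (fun=> 1%N) n).
Proof. by rewrite /line /= all_map; apply/allP. Qed.

Definition point_tree : spined_tree ev :=
  @SpinedTree R J W ev
    (@MarkedTree R J W ev line (fun=> 0%N) (fun=> 1)
      (fun v t => ev (t - birth_time (fun=> 1 : R) v) point)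
      isT line_prefix line_children (fun _ _ => ltr01) path1 no_explosion1)
    (fun=> 1%N) spine1.

HB.instance Definition _ := gen_eqMixin (spined_tree ev).
HB.instance Definition _ := gen_choiceMixin (spined_tree ev).
HB.instance Definition _ := isPointed.Build (spined_tree ev) point_tree.

End pointed.

Section trees.
Variables (R : realType) (J W : Type) (ev : R -> W -> J).
Implicit Types (T : marked_tree ev) (S : spined_tree ev) (t : R).

Definition birth T (u : seq nat) : R := birth_time (life T) u.
Definition death T (u : seq nat) : R := death_time (life T) u.

(* [N_t] *)
Definition alive T t : set (seq nat) :=
  [set u | tau T u /\ birth T u <= t < death T u].

(* The extended path: [anc_at T u t] is the shortest prefix of [u] dying after
   [t], which is the one alive at time [t] if [0 <= t < death T u]. *)
Definition anc_at T (u : seq nat) t : seq nat :=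
  take (find (fun k => t < death T (take k u)) (iota 0 (size u).+1)) u.

Definition pos T (u : seq nat) t : J := path T (anc_at T u t) t.

(* [\prod_(v < u) (1 + A_v)] over the strict ancestors [v] of [u] *)
Definition anc_prod T (u : seq nat) : R :=
  \prod_(k < size u) (1 + off T (take k u))%N%:R.

(* The two meanings of [xi_t]: the spine node alive at time [t], and its
   position. *)
Definition spine_node S t : seq nat :=
  xget [::] [set u | (exists n, u = mkseq (spine S) n) /\ alive S t u].

Definition spine_pos S t : J := pos S (spine_node S t) t.

End trees.

Section filtrations.
Variables (R : realType) (dJ : measure_display) (J : measurableType dJ).
Variables (W : Type) (ev : R -> W -> J).
Local Notation stree := (spined_tree ev).

(* Generators of [F_t].  A path [X_u] is observed through its values at the
   deterministic times of its domain and its value at its (random) birth time;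
   the latter is redundant for right-continuous paths. *)
Inductive F_gen (t : R) : set (set stree) :=
| F_dead_life u (C : set R) : measurable C ->
    F_gen t [set S : stree | [/\ tau S u, death S u <= t & C (life S u)]]
| F_dead_start u (B : set J) : measurable B ->
    F_gen t [set S : stree | [/\ tau S u, death S u <= t &
                                 B (path S u (birth S u))]]
| F_dead_path u s (B : set J) : measurable B ->
    F_gen t [set S : stree | [/\ tau S u, death S u <= t,
                                 birth S u <= s < death S u & B (path S u s)]]
| F_alive_start u (B : set J) : measurable B ->
    F_gen t [set S : stree | alive S t u /\ B (path S u (birth S u))]
| F_alive_path u s (B : set J) : measurable B ->
    F_gen t [set S : stree | [/\ alive S t u, birth S u <= s <= t &
                                 B (path S u s)]].

Definition F_ (t : R) : set (set stree) := <<s F_gen t >>.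

Definition Ft_ (t : R) : set (set stree) :=
  <<s F_ t `|`
      [set E | exists u, E = [set S : stree | spine_node S t = u]] >>.

Definition G_ (t : R) : set (set stree) :=
  <<s [set E | exists s (B : set J),
         [/\ 0 <= s <= t, measurable B &
             E = [set S : stree | B (spine_pos S s)]]] >>.

Definition F_union : set (set stree) :=
  \bigcup_(t in [set t : R | 0 <= t]) F_ t.

Definition Ft_union : set (set stree) :=
  \bigcup_(t in [set t : R | 0 <= t]) Ft_ t.

(* [f = \sum_(u in N_t) f_u 1_(xi_t = u)] with each [f_u] [F_t]-measurable;
   [N_t] is finite, because there is no explosion. *)
Definition spine_decomposition (t : R) (f : stree -> R)
    (f_ : seq nat -> stree -> R) : Prop :=
  (forall u, meas_wrt (F_ t) (f_ u)) /\
  (forall S, f S =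
     \sum_(u \in alive S t) (f_ u S * (spine_node S t == u)%:R)).

End filtrations.

(* [P] lives on [F_infty], [Ptilde] and [Qtilde] on [Ftilde_infty]. *)
Notation F_infty_type ev := (g_sigma_algebraType (F_union (ev := ev))).
Notation Ft_infty_type ev := (g_sigma_algebraType (Ft_union (ev := ev))).

(* A generic event about the life of a particle: lifetime in [test_life],
   number of extra children in [test_off], children born in [test_end] and, for
   each [i < test_n], particle alive at the absolute time [test_time i] with a
   position in [test_pos i]. *)
Record mark_test (R : realType) (dJ : measure_display)
    (J : measurableType dJ) := MarkTest {
  test_life : set R;
  test_off : set nat;
  test_end : set J;
  test_n : nat;
  test_time : nat -> R;
  test_pos : nat -> set J;
  measurable_test_life : measurable test_life;
  measurable_test_end : measurable test_end;
  measurable_test_pos : forall i, measurable (test_pos i) }.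

(* [b] birth time, [s] lifetime, [a] offspring variable, [X] path, [z] position
   where the children are born *)
Definition mark_in (R : realType) (dJ : measure_display)
    (J : measurableType dJ) (e : mark_test R J) (b s : R) (a : nat)
    (X : R -> J) (z : J) : Prop :=
  [/\ test_life e s, test_off e a, test_end e z &
      forall i, (i < test_n e)%N ->
        b <= test_time e i < b + s /\ test_pos e i (X (test_time e i))].

Section branching.
Variables (R : realType) (dJ dW : measure_display).
Variables (J : measurableType dJ) (W : measurableType dW) (ev : R -> W -> J).
Variables (Xi : R.-pker J ~> W) (rate : J -> R) (p : R.-pker J ~> nat).
Local Notation stree := (spined_tree ev).

(* Probability of [e] for a particle born at time [b] at [y]: it moves along a
   trajectory [w] with law [Xi y]; dying with intensity [rate] along [w], its
   lifetime has conditional density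
   [s |-> rate (w s) * exp (- \int_0^s rate (w r) dr)]; dying after a lifetime
   [s] it has [1 + A] children at [ev s w], where [A] has law [p (ev s w)]. *)
Definition mark_law (b : R) (y : J) (e : mark_test R J) : \bar R :=
  (\int[Xi y]_w \int[lebesgue_measure]_(s in `[0%R, +oo[)
     (p (ev s w) [set a | mark_in e b s a (fun r => ev (r - b)%R w) (ev s w)]
      * (rate (ev s w))%:E
      * expeR (- \int[lebesgue_measure]_(r in `[0%R, s])
                   (rate (ev r w))%:E)))%E.

(* Generators of the information about the particles of the generations before
   [n] and about the births of generation [n]. *)
Inductive past_gen (n : nat) : set (set stree) :=
| past_born u : (size u <= n)%N -> past_gen n [set S : stree | tau S u]
| past_start u (B : set J) : (size u <= n)%N -> measurable B ->
    past_gen n [set S : stree | tau S u /\ B (path S u (birth S u))]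
| past_life u (C : set R) : (size u < n)%N -> measurable C ->
    past_gen n [set S : stree | tau S u /\ C (life S u)]
| past_path u s (B : set J) : (size u < n)%N -> measurable B ->
    past_gen n [set S : stree | [/\ tau S u,
                                    birth S u <= s < death S u &
                                    B (path S u s)]].

(* [P] is the law of the branching Markov process started from one particle at
   [x]: given the past of generation [n], the particles of generation [n] are
   independent, with the above law. *)
Definition branching_law (P : probability (F_infty_type ev) R) (x : J) :
    Prop :=
  (forall B : set J, measurable B ->
     P [set S : stree | B (path S [::] 0)] = (\1_B x)%:E) /\
  (forall (n : nat) (H : set stree) (us : seq (seq nat))
          (e : seq nat -> mark_test R J),
     (<<s past_gen n >>) H -> uniq us -> all (fun u => size u == n) us ->
     (P (H `&` [set S : stree | forall u, u \in us -> tau S u /\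
            forall j, (1 <= j <= 1 + off S u)%N ->
              mark_in (e u) (birth S u) (life S u) (off S u) (path S u)
                (path S (rcons u j) (birth S (rcons u j)))]) =
      \int[P]_(S in H `&` [set S : stree |
            forall u, u \in us -> tau S u])
         \prod_(u <- us) mark_law (birth S u) (path S u (birth S u)) (e u))%E).

(* [Ptilde]: at each fission the spine follows a uniformly chosen child. *)
Definition spine_law (P : probability (F_infty_type ev) R)
    (Pt : probability (Ft_infty_type ev) R) : Prop :=
  forall (t : R) (f : stree -> R)
         (f_ : seq nat -> stree -> R),
    0 <= t -> meas_wrt (Ft_ t) f -> (forall S, 0 <= f S) ->
    spine_decomposition t f f_ ->
    (\int[Pt]_S (f S)%:E =
     \int[P]_S (\sum_(u \in alive S t) (f_ u S / anc_prod S u))%R%:E)%E.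

Definition mR (y : J) : R := mean_offspring p y * rate y.

Definition discount (S : stree) (u : seq nat) (t : R) : R :=
  expR (- \int[lebesgue_measure]_(s in `[0, t]) mR (pos S u s)).

Definition Z_ (zeta_ : R -> seq nat -> stree -> R) (t : R)
    (S : stree) : R :=
  \sum_(u \in alive S t) (discount S u t * zeta_ t u S).

Definition zetat (zeta : R -> stree -> R) (t : R)
    (S : stree) : R :=
  anc_prod S (spine_node S t) * discount S (spine_node S t) t * zeta t S.

End branching.

(* Main.v *)
(* Write [a_u = exp(- \int_0^t m R (X_u)) zeta_u(t)], [Z = \sum_u a_u] and
   [N = \sum_u g(X_u(t)) a_u], the sums being over the particles alive at time
   [t].  For [f >= 0] measurable with respect to [Ftilde_t], the density of
   [Qtilde] and the definition of [Ptilde] give the many-to-one formula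
     [Qtilde(f) = P (\sum_u f_u a_u / zeta(0))],
   the factors [1 + A_v] of [zetatilde] cancelling those of [Ptilde].  For [A] in
   [F_t], the choices [f = 1_A g(xi_t)] and [f = 1_A N / Z] give the same
   integrand [1_A N / zeta(0)], so that [N / Z] is a version of
   [Qtilde(g(xi_t) | F_t)].

   The time integrals along the paths are not assumed to be [F_t]-measurable.
   This follows from the measurability of [zetatilde(t)]: an event of [F_t] does
   not depend on the spine and an event of [Ftilde_t] coincides on [{xi_t = u}]
   with one of [F_t], so moving the spine of a tree through [u] turns an
   [Ftilde_t]-measurable function into an [F_t]-measurable function on
   [{u in N_t}]. *)

Require Import Defs.
From mathcomp Require Import all_boot all_order all_algebra.
From mathcomp Require Import all_classical all_reals all_analysis.
From mathcomp Require Import measurable_realfun.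

Set Implicit Arguments.
Unset Strict Implicit.
Unset Printing Implicit Defensive.

Import Order.TTheory GRing.Theory Num.Theory.
Import numFieldNormedType.Exports.

Local Open Scope classical_set_scope.
Local Open Scope ring_scope.

(** * Trees and spines *)

Section tree_facts.
Variables (R : realType) (J W : Type) (ev : R -> W -> J).
Implicit Types (T : marked_tree ev) (S : spined_tree ev).
Implicit Types (u v : seq nat) (t : R).

(** * Birth and death times along a line of descent *)

Lemma take_mkseq (l : nat -> nat) m n :
  (m <= n)%N -> take m (mkseq l n) = mkseq l m.
Proof. by move=> mn; rewrite /mkseq -map_take take_iota (minn_idPl mn). Qed.

Lemma tau_take T u k : tau T u -> tau T (take k u).
Proof.
by move=> Tu; apply: (@tau_prefix _ _ _ _ T _ (drop k u)); rewrite cat_take_drop.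
Qed.

Lemma death_take T u k : (k <= size u)%N ->
  death T (take k u) = \sum_(i < k.+1) life T (take i u).
Proof.
move=> ku; rewrite /death /death_time size_take_min (minn_idPl ku).
by apply: eq_bigr => i _; rewrite take_takel// -ltnS.
Qed.

Lemma birthE T u : birth T u = \sum_(i < size u) life T (take i u).
Proof.
by rewrite /birth /birth_time /death_time big_ord_recr/= take_size addrK.
Qed.

Lemma deathE T u : death T u = birth T u + life T u.
Proof. by rewrite /birth /birth_time subrK. Qed.

Lemma birth_nil T : birth T [::] = 0.
Proof. by rewrite birthE big_ord0. Qed.

Lemma death_take_le_birth T u k : tau T u -> (k < size u)%N ->
  death T (take k u) <= birth T u.
Proof.
move=> Tu ku; rewrite death_take ?(ltnW ku)// birthE.
rewrite -!(big_mkord xpredT (fun i => life T (take i u))).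
rewrite (big_cat_nat (n := k.+1) (leq0n _) ku)/= lerDl.
by apply: sumr_ge0 => i _; exact/ltW/life_gt0/tau_take.
Qed.

Lemma birth_lt_death T u : tau T u -> birth T u < death T u.
Proof. by move=> Tu; rewrite deathE ltrDl life_gt0. Qed.

(** A strict prefix of [u] dies no later than [u] is born, so the particles alive at one time form
    an antichain for the ancestor order. *)
Lemma alive_take T t u k :
  alive T t u -> alive T t (take k u) -> take k u = u.
Proof.
move=> [Tu /andP[bu _]] [_ /andP[_ du]].
case: (ltnP k (size u)) => ku; last first.
  by rewrite take_oversize.
have := lt_le_trans du (le_trans (death_take_le_birth Tu ku) bu).
by rewrite ltxx.
Qed.

Lemma alive_mkseq_eq T t l m n :
  alive T t (mkseq l m) -> alive T t (mkseq l n) -> mkseq l m = mkseq l n.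
Proof.
wlog mn : m n / (m <= n)%N => [H am an|am an].
  by case: (leqP m n) => [|/ltnW] mn; [|symmetry]; apply: H.
by move: am; rewrite -(take_mkseq _ mn) => /(alive_take an).
Qed.

Lemma alive_line T t l : (forall n, tau T (mkseq l n)) -> 0 <= t ->
  exists n, alive T t (mkseq l n).
Proof.
by move=> Tl t0; have [n [an _]] := no_explosion Tl t0; exists n; split.
Qed.

(** No explosion along the spine provides a node, so at nonnegative times [xget] never falls back on
    its default value [[::]]. *)
Lemma spine_nodeP S t : 0 <= t ->
  alive S t (spine_node S t) /\ exists n, spine_node S t = mkseq (spine S) n.
Proof.
move=> t0; have [n an] := alive_line (@spine_tau _ _ _ _ S) t0.
rewrite /spine_node; case: xgetP => [u -> [[m ->] au]|/(_ (mkseq (spine S) n))].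
  by split=> //; exists m.
by case; split=> //; exists n.
Qed.

Lemma alive_spine_node S t : 0 <= t -> alive S t (spine_node S t).
Proof. by move=> /(spine_nodeP S)[]. Qed.

Lemma spine_node_eq S t n : 0 <= t ->
  alive S t (mkseq (spine S) n) -> spine_node S t = mkseq (spine S) n.
Proof.
move=> /(spine_nodeP S)[a1 [m E]] a2; rewrite E in a1 *.
exact: alive_mkseq_eq a1 a2.
Qed.

Lemma anc_at_alive T t u : alive T t u -> anc_at T u t = u.
Proof.
(* The search must run up to [size u]: a shorter prefix is dead by the birth of [u], hence by time
   [t]. *)
move=> [Tu /andP[bu du]]; rewrite /anc_at take_oversize//.
rewrite leqNgt; apply/negP => H; have ltF := ltn_trans H (ltnSn (size u)).
have := nth_find 0%N (a := fun k => t < death T (take k u))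
  (s := iota 0 (size u).+1).
rewrite has_find size_iota => /(_ ltF); rewrite nth_iota// add0n => du'.
have := lt_le_trans du' (le_trans (death_take_le_birth Tu H) bu).
by rewrite ltxx.
Qed.

(** The root is alive at time [0] and is a prefix of every word, so the antichain property excludes
    all other particles. *)
Lemma alive0 T u : alive T 0 u <-> u = [::].
Proof.
have a0 : alive T 0 [::].
  split; first exact: tau_root.
  by rewrite birth_nil lexx -(birth_nil T) birth_lt_death//; exact: tau_root.
split=> [au|->//]; have := @alive_take T 0 u 0 au.
by rewrite take0 => /(_ a0) <-.
Qed.

(** Past the end of [u], the default letter [1%N] continues the line through first children, which
    exist because every particle has [1 + A >= 1] children. *)
Lemma tau_mkseq_nth T u n : tau T u -> tau T (mkseq (nth 1%N u) n).
Proof.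
move=> Tu; elim: n => [|n IH]; first exact: tau_root.
case: (ltnP n (size u)) => nu.
  rewrite -(@take_mkseq _ _ (size u))//.
  by apply: tau_take; rewrite mkseq_nth.
by rewrite mkseqS nth_default//; exact/tau_children.
Qed.

Definition respine S u (Su : tau S u) : spined_tree ev :=
  SpinedTree (fun n => tau_mkseq_nth n Su).

Lemma spine_node_respine S u (Su : tau S u) t : 0 <= t -> alive S t u ->
  spine_node (respine Su) t = u.
Proof.
by move=> t0 au; rewrite (@spine_node_eq _ _ (size u)) ?mkseq_nth.
Qed.

(* Koenig's lemma: an infinite [alive T t] would contain, below each node of
   some infinite line, infinitely many particles; but nothing below the node of
   that line alive at time [t] is alive at time [t]. *)
Lemma finite_alive T t : 0 <= t -> finite_set (alive T t).
Proof.
move=> t0; apply: contrapT => infT.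
pose D u := alive T t `&` [set v | prefix u v].
have step u : infinite_set (D u) -> exists j, infinite_set (D (rcons u j)).
  move=> infu; apply/existsNP => fin; apply: infu.
  have [[v [[Tv _] /prefixP[w vE]]]|/set0P/negP/negPn/eqP->//] :=
    pselect (D u !=set0).
  have Tu : tau T u by apply: (@tau_prefix _ _ _ _ T _ w); rewrite -vE.
  (* The children of [u] carry the labels [1] to [1 + off T u], all below [(off T u).+2]. *)
  apply: (@sub_finite_set _ _
    ([set u] `|` \bigcup_(j in `I_(off T u).+2) D (rcons u j))).
    move=> x [ax /prefixP[[|j y] xE]]; first by left; rewrite /= xE cats0.
    have Tj : tau T (rcons u j).
      apply: (@tau_prefix _ _ _ _ T _ y); rewrite cat_rcons -xE.
      by case: ax.
    right; exists j; first by have /(tau_children j Tu)/andP[_] := Tj.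
    by split=> //=; rewrite xE -cat_rcons prefix_prefix.
  rewrite finite_setU; split; first exact: finite_set1.
  apply: bigcup_finite; first exact: finite_II.
  by move=> j _; have /contrapT := fin j.
have [next nextP] : {f : seq nat -> nat &
    forall u, infinite_set (D u) -> infinite_set (D (rcons u (f u)))}.
  apply: (@choice _ _
    (fun u j => infinite_set (D u) -> infinite_set (D (rcons u j)))).
  move=> u; have [/step[j ?]|?] := pselect (infinite_set (D u)); last by exists 0%N.
  by exists j.
(* The infinite line follows at each node the child selected by [next], below which infinitely many
   particles are alive. *)
pose line := fix line n :=
  if n is n'.+1 then rcons (line n') (next (line n')) else [::].
pose l n := next (line n).
have lineE n : mkseq l n = line n by elim: n => //= n IH; rewrite mkseqS IH.
have infl n : infinite_set (D (mkseq l n)).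
  rewrite lineE; elim: n => [|n /nextP//].
  by rewrite /D/= (_ : [set _ | _] = setT) ?setIT//; apply/seteqP; split=> // -[].
have Tl n : tau T (mkseq l n).
  have [v [[Tv _] /prefixP[w vE]]] := infinite_setN0 (infl n).
  by apply: (@tau_prefix _ _ _ _ T _ w); rewrite -vE.
have [n an] := alive_line Tl t0.
apply: (infl n).
apply: (@sub_finite_set _ _ [set mkseq l n]); last exact: finite_set1.
move=> v [av /prefixP[w vE]] /=.
have <- : take (size (mkseq l n)) v = v.
  by apply: (alive_take av); rewrite vE take_size_cat.
by rewrite vE take_size_cat.
Qed.

End tree_facts.

(** * Filtrations *)

(** Gives access to the closure properties of [measurable_fun] by changing the structure of the
    domain. *)
Lemma meas_wrtP (T : pointedType) (G : set (set T)) d (U : measurableType d)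
    (f : T -> U) :
  meas_wrt <<s G>> f <->
  measurable_fun [set: g_sigma_algebraType G] (f : g_sigma_algebraType G -> U).
Proof.
split=> [mf _ B mB|mf B mB]; first by rewrite setTI; exact: mf.
by rewrite -[_ @^-1` _]setTI; exact: mf.
Qed.

Section filtration_facts.
Variables (R : realType) (dJ : measure_display) (J : measurableType dJ).
Variables (W : pointedType) (ev : R -> W -> J).
Local Notation stree := (spined_tree ev).
Implicit Types (S : stree) (u v : seq nat) (t : R) (A E : set stree).
Local Notation F_ := (@F_ R dJ J W ev).
Local Notation Ft_ := (@Ft_ R dJ J W ev).
Local Notation FT t := (g_sigma_algebraType (F_gen (ev := ev) t)).

Lemma birth_rcons (T : marked_tree ev) v j : birth T (rcons v j) = death T v.
Proof.
rewrite birthE size_rcons /death /death_time; apply: eq_bigr => i _.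
by rewrite -cats1 takel_cat// -ltnS.
Qed.

(** The generators of [F_ t] mention only the marked tree. Quantifying over both trees makes the
    property symmetric, hence stable under complements. *)
Lemma F_mtree t A S S' : F_ t A -> mtree S = mtree S' -> A S -> A S'.
Proof.
move=> FA; move: S S'.
apply: (FA [set A | forall S S', mtree S = mtree S' -> A S -> A S']).
split.
- split=> [//|B IB S S' SS' [_ BS]|B IB S S' SS' [n _ BnS]].
  + by split=> // /(IB _ _ (esym SS')).
  + by exists n => //; exact: IB SS' BnS.
- by move=> _ [] *; move=> S S' E /=; rewrite E.
Qed.

Lemma sub_F_gen t A : F_gen t A -> F_ t A.
Proof. exact: sub_sigma_algebra. Qed.

Lemma F_sub_Ft t : F_ t `<=` Ft_ t.
Proof. by move=> A FA; apply: sub_sigma_algebra; left. Qed.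

Lemma Ft_sub_Ft_infty t : 0 <= t ->
  Ft_ t `<=` @measurable _ (Ft_infty_type ev).
Proof. by move=> t0 A FA; apply: sub_sigma_algebra; exists t. Qed.

Lemma Ft_node t u : Ft_ t [set S : stree | spine_node S t = u].
Proof. by apply: sub_sigma_algebra; right; exists u. Qed.

Lemma F_alive t u : F_ t [set S : stree | alive S t u].
Proof.
have := sub_F_gen (F_alive_start ev t u (@measurableT _ J)).
by congr F_; apply/seteqP; split=> S //= -[].
Qed.

Lemma F_born t u : F_ t [set S : stree | tau S u /\ birth S u <= t].
Proof.
have D := sub_F_gen (F_dead_start ev t u (@measurableT _ J)).
rewrite (_ : mkset _ = [set S : stree | alive S t u] `|`
    [set S : stree | [/\ tau S u, death S u <= t &
                         setT (Defs.path S u (birth S u))]]).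
  exact: (@measurableU _ (FT t) _ _ (@F_alive t u) D).
apply/seteqP; split=> S /= => [[Su bu]|[[Su /andP[]]//|[Su du _]]].
  by case: (leP (death S u) t) => du; [right|left; split=> //; rewrite bu].
by split=> //; exact/ltW/(lt_le_trans (birth_lt_death Su)).
Qed.

Lemma F_alive_pos t u (B : set J) : measurable B ->
  F_ t [set S : stree | alive S t u /\ B (pos S u t)].
Proof.
move=> mB; have := sub_F_gen (@F_alive_path _ _ _ _ ev t u t _ mB).
congr F_; apply/seteqP; split=> S /=.
  by move=> [au _ Bp]; rewrite /pos anc_at_alive.
move=> [au]; rewrite /pos anc_at_alive// => Bp; split=> //.
by rewrite lexx andbT; case: au => _ /andP[].
Qed.

(** The generators of [F_ t] do not record offspring numbers, but these can be read off the children
    born: [A_v = m] when the child [m.+1] exists and the child [m.+2] does not. Both would be born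
    at the death of [v], which precedes [t] because [v] is a strict ancestor of a particle alive at
    [t]. *)
Lemma F_alive_off t u k m : (k < size u)%N ->
  F_ t [set S : stree | alive S t u /\ off S (take k u) = m].
Proof.
move=> ku.
rewrite (_ : mkset _ = [set S : stree | alive S t u] `&`
  ([set S : stree | tau S (rcons (take k u) m.+1) /\
                    birth S (rcons (take k u) m.+1) <= t] `\`
   [set S : stree | tau S (rcons (take k u) m.+2) /\
                    birth S (rcons (take k u) m.+2) <= t])).
  apply: (@measurableI _ (FT t)); first exact: F_alive.
  by apply: (@measurableD _ (FT t)); exact: F_born.
apply/seteqP; split=> S /=; rewrite !birth_rcons => -[au].
  have [Su /andP[bu _]] := au; have Sk := tau_take k Su.
  move=> om; have dk : death S (take k u) <= t.
    exact: le_trans (death_take_le_birth Su ku) bu.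
  split=> //; split.
    by split=> //; apply/(tau_children _ Sk); rewrite om /= add1n.
  by move=> [/(tau_children _ Sk)]; rewrite om add1n ltnn andbF.
move=> [[Sj dk] nt]; split=> //.
have Sk := tau_take k (proj1 au).
move/(tau_children _ Sk): Sj => /andP[_]; rewrite add1n ltnS => om.
apply/eqP; rewrite eqn_leq om andbT leqNgt; apply/negP => mo.
apply: nt; split=> //; apply/(tau_children _ Sk).
by rewrite add1n [X in _ && X]ltnS.
Qed.

(** There are countably many words, so measurability may be checked on each cell of the partition by
    the spine node. *)
Lemma Ft_nodeP t E :
  (forall u, Ft_ t (E `&` [set S : stree | spine_node S t = u])) -> Ft_ t E.
Proof.
move=> H; have <- : \bigcup_u (E `&` [set S : stree | spine_node S t = u]) = E.
  apply/seteqP; split=> [S [u _ []]//|S ES].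
  by exists (spine_node S t).
exact: (@countable_bigcupT_measurable _ (g_sigma_algebraType _) _ _ _ H).
Qed.

(** The events with this property form a sigma-algebra. It contains [F_ t], and also the node
    events, which on [{xi_t = u}] are everything or empty. *)
Lemma Ft_trace t E u : Ft_ t E ->
  exists2 A, F_ t A & forall S, spine_node S t = u -> (E S <-> A S).
Proof.
move=> FE; move: u; apply: (FE [set E | forall u,
  exists2 A, F_ t A & forall S, spine_node S t = u -> (E S <-> A S)]).
split.
  split.
  - by move=> u; exists set0 => //; exact: sigma_algebra0.
  - move=> B IB u; have [A FA BA] := IB u; exists (setT `\` A).
      exact: sigma_algebraCD.
    move=> S Su.
    by split=> -[_ nS]; split=> //; apply: contra_not nS => /(BA _ Su).
  - move=> B IB u.
    have [A AP] : {A : nat -> set stree & forall n, F_ t (A n) /\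
        forall S, spine_node S t = u -> (B n S <-> A n S)}.
      apply: (@choice _ _ (fun n A => F_ t A /\
         forall S, spine_node S t = u -> (B n S <-> A S))) => n.
      by have [A ? ?] := IB n u; exists A.
    exists (\bigcup_n A n).
      by apply: sigma_algebra_bigcup => n; have [] := AP n.
    move=> S Su; split=> -[n _] H; exists n => //;
      by have [_ /(_ _ Su)[]] := AP n; auto.
move=> B [FB|[v ->]] u; first by exists B.
have [->|uv] := eqVneq u v.
  by exists setT => //; exact: (@measurableT _ (FT t)).
exists set0; first exact: sigma_algebra0.
by move=> S /= ->; split=> // /eqP; rewrite (negbTE uv).
Qed.

Lemma Ft_mtree_node t E S S' : Ft_ t E -> mtree S = mtree S' ->
  spine_node S t = spine_node S' t -> E S -> E S'.
Proof.
move=> FE SS' nSS'; have [A FA AP] := Ft_trace (spine_node S t) FE.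
by move=> /(AP _ erefl)/(F_mtree FA SS')/(AP _ (esym nSS')).
Qed.

(** The preimage of the point [f S] is an event of [Ft_ t] containing [S], hence also [S']. *)
Lemma meas_Ft_mtree t (f : stree -> R) S S' : meas_wrt (Ft_ t) f ->
  mtree S = mtree S' -> spine_node S t = spine_node S' t -> f S = f S'.
Proof.
move=> mf SS' nSS'; apply/esym.
exact: (@Ft_mtree_node t (f @^-1` [set f S]) S S' (mf _ (measurable_set1 _))).
Qed.

Lemma meas_F_mtree t (f : stree -> R) S S' : meas_wrt (F_ t) f ->
  mtree S = mtree S' -> f S = f S'.
Proof.
move=> mf SS'; apply/esym.
exact: (@F_mtree t (f @^-1` [set f S]) S S' (mf _ (measurable_set1 _))).
Qed.

(* The value of [f] on the tree [S] if its spine is made to pass through [u] *)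
Definition spine_part t (f : stree -> R) u S : R :=
  if pselect (alive S t u) is left au then f (respine (proj1 au)) else 0.

Lemma spine_partN t f u S : ~ alive S t u -> spine_part t f u S = 0.
Proof. by rewrite /spine_part; case: pselect. Qed.

(** Hides the proof argument of [respine]: later arguments use only some tree with the same marks
    whose spine is at [u]. *)
Lemma spine_partP t f u S : alive S t u -> 0 <= t -> exists S',
  [/\ mtree S' = mtree S, spine_node S' t = u & spine_part t f u S = f S'].
Proof.
rewrite /spine_part; case: pselect => // au a t0; exists (respine (proj1 au)).
by split=> //; rewrite spine_node_respine.
Qed.

Lemma meas_spine_part t f u : 0 <= t -> meas_wrt (Ft_ t) f ->
  meas_wrt (F_ t) (spine_part t f u).
Proof.
move=> t0 mf B mB; have [A FA AP] := Ft_trace u (mf _ mB).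
rewrite (_ : _ @^-1` _ = ([set S : stree | alive S t u] `&` A) `|`
    (if pselect (B 0) then ~` [set S : stree | alive S t u] else set0)).
  apply: (@measurableU _ (FT t)).
    by apply: (@measurableI _ (FT t)) => //; exact: F_alive.
  case: pselect => B0; last exact: sigma_algebra0.
  by apply: (@measurableC _ (FT t)); exact: F_alive.
apply/seteqP; split=> S /=.
  have [au|nau] := pselect (alive S t u); last first.
    by rewrite spine_partN// => B0; right; case: pselect.
  have [S' [SS' S'u ->]] := spine_partP f au t0.
  by move=> BS'; left; split=> //; exact/(F_mtree FA SS')/(AP _ S'u).
move=> [[au AS]|]; last by case: pselect => // B0 nau; rewrite spine_partN.
have [S' [SS' S'u ->]] := spine_partP f au t0.
exact/(AP _ S'u)/(F_mtree FA (esym SS')).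
Qed.

(** * Decompositions and sums over the particles alive *)

Lemma sum_alive_node t (F : seq nat -> R) S : 0 <= t ->
  \sum_(u \in alive S t) (F u * (spine_node S t == u)%:R) = F (spine_node S t).
Proof.
move=> t0; have an := alive_spine_node S t0.
rewrite -(fsbig_widen [set spine_node S t]).
- by rewrite fsbig_set1 eqxx mulr1.
- by move=> _ ->.
- by move=> u /= [_ /eqP]; rewrite eq_sym => /negbTE ->; rewrite mulr0.
Qed.

(** Supplies the decomposition that [spine_law] asks for. *)
Lemma spine_part_decomposition t f : 0 <= t -> meas_wrt (Ft_ t) f ->
  spine_decomposition t f (spine_part t f).
Proof.
move=> t0 mf; split=> [u|S]; first exact: meas_spine_part.
rewrite (sum_alive_node (fun u => spine_part t f u S))//.
have [S' [SS' S'u ->]] := spine_partP f (alive_spine_node S t0) t0.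
by apply: (meas_Ft_mtree mf) => //; exact: esym.
Qed.

(** Uniqueness of the decomposition where [u] is alive: moving the spine through [u] leaves only the
    term [f_ u], whose value does not depend on the spine. *)
Lemma spine_decomposition_part t f f_ u S : 0 <= t ->
  spine_decomposition t f f_ -> alive S t u -> f_ u S = spine_part t f u S.
Proof.
move=> t0 [mf_ fE] au; have [S' [SS' S'u ->]] := spine_partP f au t0.
rewrite fE (sum_alive_node (fun u => f_ u S'))// S'u.
by apply: (meas_F_mtree (mf_ u)); exact: esym.
Qed.

Lemma meas_alive_part t u (f : stree -> R) : meas_wrt (F_ t) f ->
  meas_wrt (F_ t) (fun S => if pselect (alive S t u) then f S else 0).
Proof.
move=> mf; apply/meas_wrtP.
rewrite (_ : (fun S => _) = f \* \1_[set S : stree | alive S t u]); last first.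
  apply/funext => S /=; rewrite indicE; case: pselect => au.
    by rewrite mem_set// mulr1.
  by rewrite memNset// mulr0.
apply: measurable_funM; first exact/meas_wrtP.
exact: (@measurable_indic _ (FT t) _ _ _ (@F_alive t u)).
Qed.

(** The index set is random but finite, so the sum is a pointwise limit, eventually constant, of
    sums over fixed finite lists of words. *)
Lemma meas_sum_alive t (f_ : seq nat -> stree -> R) : 0 <= t ->
  (forall u, meas_wrt (F_ t) (f_ u)) ->
  meas_wrt (F_ t) (fun S => \sum_(u \in alive S t) f_ u S).
Proof.
move=> t0 mf; pose c u S : R := if pselect (alive S t u) then f_ u S else 0.
pose words n : seq (seq nat) := pmap pickle_inv (iota 0 n).
apply/meas_wrtP; apply: (@measurable_fun_cvg _ (FT t) _ _
  (fun n S => \sum_(u <- words n) c u S)) => [n|S _].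
  by apply: measurable_sum => u; apply/meas_wrtP; exact: meas_alive_part.
have /finite_seqP[s sE] := finite_alive S t0.
(* From [N] on, the list of words of code below [n] contains every particle alive in [S]. *)
pose N := \max_(u <- s) (pickle u).+1.
apply: cvg_near_cst; exists N => // n /= Nn.
transitivity (\sum_(u \in alive S t) c u S); last first.
  by apply: eq_fsbigr => u; rewrite inE /c; case: pselect.
apply/esym/(@fsbig_fwiden _ _ _ _ (words n)).
- move=> u au /=; rewrite mem_pmap; apply/mapP; exists (pickle u).
    rewrite mem_iota add0n (leq_trans _ Nn)// /N.
    rewrite (@leq_bigmax_seq _ _ xpredT (fun u => (pickle u).+1))//.
    by move: au; rewrite sE.
  by rewrite pickleK_inv.
- by apply: (pmap_uniq (@pickle_invK _)); exact: iota_uniq.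
- by move=> u /= [_ nau]; rewrite /c; case: pselect.
Qed.

Lemma meas_anc_prod_node t : 0 <= t ->
  meas_wrt (Ft_ t) (fun S => anc_prod S (spine_node S t)).
Proof.
move=> t0 B mB; apply: Ft_nodeP => u.
(* The factors are set to [0] where [u] is not alive, since [F_ t] determines the offspring numbers
   of its ancestors only where it is. *)
pose c k S : R :=
  if pselect (alive S t u) then (1 + off S (take k u))%N%:R else 0.
have mc (k : 'I_(size u)) : meas_wrt (F_ t) (c k).
  move=> C mC; rewrite (_ : _ @^-1` _ =
    \bigcup_m (if pselect (C (1 + m)%N%:R) then
                 [set S : stree | alive S t u /\ off S (take k u) = m]
               else set0) `|`
    (if pselect (C 0) then ~` [set S : stree | alive S t u] else set0)).
    apply: (@measurableU _ (FT t)).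
      apply: sigma_algebra_bigcup => m; case: pselect => Cm.
        exact: F_alive_off.
      exact: sigma_algebra0.
    case: pselect => B0; last exact: sigma_algebra0.
    by apply: (@measurableC _ (FT t)); exact: F_alive.
  apply/seteqP; split=> S /=; rewrite /c; case: (pselect (alive S t u)) => au.
  - by move=> Cc; left; exists (off S (take k u)) => //; case: pselect.
  - by move=> C0; right; case: pselect.
  - move=> [[m _]|]; last by case: pselect.
    by case: pselect => // Cm [_ ->].
  - move=> [[m _]|]; last by case: pselect.
    by case: pselect => // Cm [].
have mp : meas_wrt (F_ t) (fun S => \prod_(k < size u) c k S).
  apply/meas_wrtP; apply: measurable_prod => k _.
  exact: (proj1 (meas_wrtP _ _) (mc k)).
rewrite (_ : _ `&` _ = (fun S => \prod_(k < size u) c k S) @^-1` B `&`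
    [set S : stree | spine_node S t = u]).
  apply: (@measurableI _ (g_sigma_algebraType _)); last exact: Ft_node.
  by apply: F_sub_Ft; exact: mp.
have cE S : spine_node S t = u -> \prod_(k < size u) c k S = anc_prod S u.
  move=> Su; apply: eq_bigr => k _; rewrite /c; case: pselect => // -[].
  by rewrite -Su; exact: alive_spine_node.
by apply/seteqP; split=> S /= [BS Su]; split=> //; move: BS; rewrite cE// Su.
Qed.

Lemma meas_spine_pos t (h : J -> R) : 0 <= t -> measurable_fun setT h ->
  meas_wrt (Ft_ t) (fun S => h (spine_pos S t)).
Proof.
move=> t0 mh B mB; apply: Ft_nodeP => u.
rewrite (_ : _ `&` _ =
    [set S : stree | alive S t u /\ (h @^-1` B) (pos S u t)] `&`
    [set S : stree | spine_node S t = u]).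
  apply: (@measurableI _ (g_sigma_algebraType _)); last exact: Ft_node.
  by apply: F_sub_Ft; apply: F_alive_pos; rewrite -[_ @^-1` _]setTI; exact: mh.
rewrite /spine_pos; apply/seteqP; split=> S /= => [[BS Su]|[[au BS] Su]].
  by split=> //; rewrite -Su; split=> //; exact: alive_spine_node.
by rewrite Su.
Qed.

(** At time [0] the spine is at the root, whose starting position is observed by [F_ t] whether the
    root is alive or dead at time [t]. *)
Lemma G0_sub_F t : 0 <= t -> G_ (ev := ev) 0 `<=` F_ t.
Proof.
move=> t0; apply: smallest_sub; first exact: smallest_sigma_algebra.
move=> _ [s [B [/le_anti s0 mB ->]]]; rewrite -{}s0.
have D := sub_F_gen (F_dead_start ev t [::] mB).
have L := sub_F_gen (F_alive_start ev t [::] mB).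
rewrite (_ : mkset _ =
  [set S : stree | alive S t [::] /\ B (Defs.path S [::] (birth S [::]))] `|`
  [set S : stree | [/\ tau S [::], death S [::] <= t &
                       B (Defs.path S [::] (birth S [::]))]]).
  exact: (@measurableU _ (FT t) _ _ L D).
have sp S : spine_pos S 0 = Defs.path S [::] (birth S [::]).
  have a0 := alive_spine_node S (lexx 0).
  have := a0; rewrite alive0 => n0.
  by rewrite /spine_pos /pos anc_at_alive// n0 birth_nil.
have S0 S : tau S [::] := tau_root S.
apply/seteqP; split=> S /=; rewrite sp; last by move=> [[]|[]].
move=> BS; case: (leP (death S [::]) t) => dt; [by right|left].
by split=> //; split=> //; rewrite dt birth_nil t0.
Qed.

End filtration_facts.

(** * Densities and conditional expectations *)

Section density.
Import HBNNSimple.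
Local Open Scope ereal_scope.

(** Monotone convergence along simple functions reduces the claim to indicators, where it is
    [nuE]. *)
Lemma ge0_integral_density d (T : measurableType d) (R : realType)
    (mu nu : {measure set T -> \bar R}) (D : T -> R) (f : T -> \bar R) :
  measurable_fun setT D -> (forall x, (0 <= D x)%R) ->
  (forall A, measurable A -> nu A = \int[mu]_(x in A) (D x)%:E) ->
  measurable_fun setT f -> (forall x, 0 <= f x) ->
  \int[nu]_x f x = \int[mu]_x (f x * (D x)%:E).
Proof.
move=> mD D0 nuE mf f0; have mDE : measurable_fun setT (EFin \o D).
  exact/measurable_EFinP.
pose h := nnsfun_approx measurableT mf.
have cvgh x : (EFin \o h n) x @[n --> \oo] --> f x.
  by apply: cvg_nnsfun_approx.
have mh n : measurable_fun setT (EFin \o h n).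
  exact/measurable_EFinP/measurable_funP.
have ndh x : {homo (fun n => (h n x)%:E) : n m / (n <= m)%N >-> n <= m}.
  by move=> m n mn; rewrite lee_fin; exact/lefP/nd_nnsfun_approx.
have -> : \int[nu]_x f x = limn (fun n => \int[nu]_x (h n x)%:E).
  rewrite -monotone_convergence//.
    by apply: eq_integral => x _; apply/esym/cvg_lim => //; exact: cvgh.
  by move=> n x _; rewrite lee_fin.
have -> : \int[mu]_x (f x * (D x)%:E) =
    limn (fun n => \int[mu]_x ((h n x)%:E * (D x)%:E)).
  rewrite -monotone_convergence//.
  - apply: eq_integral => x _; apply/esym/cvg_lim => //.
    by apply: cvgeZr => //; exact: cvgh.
  - by move=> n; exact: (emeasurable_funM (mh n) mDE).
  - by move=> n x _; rewrite mule_ge0 ?lee_fin.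
  - by move=> x _ m n mn; rewrite lee_wpmul2r ?lee_fin//; exact: ndh.
congr (limn _); apply/funext => n.
have mind r : measurable_fun setT (fun x => (r * \1_(h n @^-1` [set r]) x)%:E).
  by apply: (measurable_comp measurableT) => //; exact: measurable_funM.
under eq_integral do rewrite fimfunE -fsumEFin//.
rewrite ge0_integral_fsum//; last by move=> r x _; exact: nnfun_muleindic_ge0.
transitivity (\int[mu]_x (\sum_(r \in range (h n))
    (r * \1_(h n @^-1` [set r]) x)%:E * (D x)%:E)); last first.
  apply: eq_integral => x _.
  rewrite -ge0_mule_fsuml; last by move=> r; exact: nnfun_muleindic_ge0.
  by rewrite fsumEFin // -(fimfunE _ x).
rewrite ge0_integral_fsum//; last 2 first.
- by move=> r; exact: (emeasurable_funM (mind r) mDE).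
- move=> r x _; apply: mule_ge0; rewrite ?lee_fin//.
  exact: nnfun_muleindic_ge0.
apply: eq_fsbigr => r /[!inE] rh.
under eq_integral do rewrite EFinM.
under [RHS]eq_integral do rewrite EFinM -muleA.
have r0 : (0 <= r)%R by case: rh => x _ <-.
have mI : measurable_fun setT (fun x => (\1_(h n @^-1` [set r]) x)%:E : \bar R).
  by apply/measurable_EFinP; exact: measurable_indic.
rewrite !ge0_integralZl//; last 2 first.
- exact: (emeasurable_funM mI mDE).
- by move=> x _; rewrite mule_ge0 ?lee_fin.
congr (_ * _); rewrite integral_indic// setIT nuE// integral_mkcond.
apply: eq_integral => x _; rewrite patchE indicE.
by case: ifP => _; rewrite ?mul1e ?mul0e.
Qed.

(* A measure is restricted to a sub-sigma-algebra by pushing it forward along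
   the identity. *)
Lemma ge0_integral_density_sub d (T : measurableType d) (R : realType)
    (mu nu : {measure set T -> \bar R}) (G : set (set T)) (D f : T -> R) :
  <<s G >> `<=` measurable ->
  meas_wrt <<s G >> D -> (forall x, (0 <= D x)%R) ->
  (forall A, <<s G >> A -> nu A = \int[mu]_(x in A) (D x)%:E) ->
  meas_wrt <<s G >> f -> (forall x, (0 <= f x)%R) ->
  \int[nu]_x (f x)%:E = \int[mu]_x (f x * D x)%:E.
Proof.
move=> GT mD D0 nuE mf f0; pose TG := g_sigma_algebraType G.
pose i : T -> TG := id.
have mi : measurable_fun setT i by move=> _ B /GT; rewrite setTI.
have {}mD : measurable_fun (setT : set TG) (D : TG -> R) by exact/meas_wrtP.
have {}mf : measurable_fun (setT : set TG) (f : TG -> R) by exact/meas_wrtP.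
have mfE : measurable_fun (setT : set TG) (EFin \o f : TG -> \bar R).
  exact/measurable_EFinP.
have mDE : measurable_fun (setT : set TG) (EFin \o D : TG -> \bar R).
  exact/measurable_EFinP.
pose mu' : {measure set TG -> \bar R} := pushforward mu i.
pose nu' : {measure set TG -> \bar R} := pushforward nu i.
transitivity (\int[nu' mi]_x (f x)%:E).
  by rewrite (ge0_integral_pushforward mi)// => x _; rewrite lee_fin.
rewrite (@ge0_integral_density _ TG _ (mu' mi) (nu' mi) D (EFin \o f))//.
- rewrite (ge0_integral_pushforward mi)//.
    exact: (emeasurable_funM mfE mDE).
  by move=> x _; rewrite -EFinM lee_fin mulr_ge0.
- move=> A mA; rewrite (ge0_integral_pushforward mi)//.
  + exact: nuE.
  + exact: measurable_funTS.
  + by move=> x _; rewrite lee_fin.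
Qed.

(** Signed [f] are covered because both integrals are differences of those of the positive and
    negative parts. *)
Lemma integral_pushforward_gsigma d (T : measurableType d) (R : realType)
    (mu : {measure set T -> \bar R}) (G : set (set T)) (A : set T)
    (f : T -> \bar R)
    (mi : measurable_fun setT (id : T -> g_sigma_algebraType G)) :
  <<s G >> A -> meas_wrt <<s G >> f ->
  \int[pushforward mu (id : T -> g_sigma_algebraType G)]_(x in A) f x =
  \int[mu]_(x in A) f x.
Proof.
move=> GA /meas_wrtP mf.
have {}mf := measurable_funTS (D := A : set (g_sigma_algebraType G)) mf.
rewrite [LHS]integralE [RHS]integralE !(ge0_integral_pushforward mi)//.
- exact: measurable_funeneg.
- exact: measurable_funepos.
Qed.

(* [Y0] is finite, hence integrable on each of the sets [`|Y0| <= n], which cover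
   the space. *)
Lemma is_cond_exp_unique d (T : measurableType d) (R : realType)
    (mu : probability T R) (G : set (set T)) (X Y : T -> \bar R) (Y0 : T -> R) :
  <<s G >> `<=` measurable ->
  is_cond_exp mu <<s G >> X (EFin \o Y0) -> is_cond_exp mu <<s G >> X Y ->
  {ae mu, forall x, (Y0 x)%:E = Y x}.
Proof.
move=> GT [mY0 iY0] [mY iY]; pose TG := g_sigma_algebraType G.
have mi : measurable_fun setT (id : T -> TG) by move=> _ B /GT; rewrite setTI.
pose push : {measure set TG -> \bar R} := pushforward mu (id : T -> TG).
pose m := push mi.
have mY0' : measurable_fun setT (EFin \o Y0 : TG -> \bar R) by exact/meas_wrtP.
have {}mY0R : measurable_fun setT (Y0 : TG -> R) by exact/measurable_EFinP.
pose A n : set TG := [set x | (`|Y0 x| <= n%:R)%R].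
have mA n : measurable (A n).
  rewrite (_ : A n = Y0 @^-1` `[(- n%:R)%R, n%:R]).
    by rewrite -[_ @^-1` _]setTI; exact: mY0R.
  by apply/seteqP; split=> x /=; rewrite /A/= in_itv/= ler_norml.
have H n : m.-negligible [set x | A n x /\ (Y0 x)%:E <> Y x].
  have : ae_eq m (A n) (EFin \o Y0) Y.
    apply: integral_ae_eq => //.
    - apply: measurable_bounded_integrable => //.
      + exact: le_lt_trans (probability_le1 mu (GT _ (mA n))) (ltry 1).
      + exact: measurable_funTS.
      + exists n%:R; split=> [|M nM y /= Ay]; first exact: num_real.
        exact: le_trans Ay (ltW nM).
    - by apply: measurable_funTS; exact/meas_wrtP.
    - by move=> E EA mE; rewrite !integral_pushforward_gsigma// iY0// iY.
  apply: negligibleS => x /= [Ax nE] /(_ Ax); exact: nE.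
(* The covering null set [B] is found in the small sigma-algebra; [GT] makes it measurable in the
   large one. *)
have [B [mB B0 NB]] := negligible_bigcup H.
exists B; split => //; first exact: GT.
move=> x /= nE; apply: NB; exists (Num.truncn `|Y0 x|).+1 => //=.
by split=> //; rewrite /A/= ltW// truncnS_gt.
Qed.

End density.

Lemma meas_wrt_indic (T : pointedType) (G : set (set T)) (R : realType)
    (A : set T) : <<s G >> A -> meas_wrt <<s G >> (\1_A : T -> R).
Proof.
move=> GA; apply/meas_wrtP.
exact: (@measurable_indic _ (g_sigma_algebraType G) _ _ _ GA).
Qed.

Lemma meas_wrtM (T : pointedType) (G : set (set T)) (R : realType)
    (f g : T -> R) : meas_wrt <<s G >> f -> meas_wrt <<s G >> g ->
  meas_wrt <<s G >> (fun x => f x * g x).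
Proof.
by move=> /meas_wrtP mf /meas_wrtP mg; apply/meas_wrtP/measurable_funM.
Qed.

Lemma meas_wrt_div (T : pointedType) (G : set (set T)) (R : realType)
    (f g : T -> R) : meas_wrt <<s G >> f -> meas_wrt <<s G >> g ->
  (forall x, 0 < g x) -> meas_wrt <<s G >> (fun x => f x / g x).
Proof.
move=> mf /meas_wrtP mg g0; apply: meas_wrtM => //; apply/meas_wrtP.
(* The inverse of a positive number is its power of exponent [-1], and powers are measurable. *)
rewrite (_ : (fun x => _) = (fun x => g x `^ (-1))).
  by apply: (measurableT_comp (measurable_powR (-1)) mg).
by apply/funext => x; rewrite powR_inv1// ltW.
Qed.

Lemma integral_indicM d (T : measurableType d) (R : realType)
    (mu : {measure set T -> \bar R}) (A : set T) (f : T -> R) :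
  (\int[mu]_(x in A) (f x)%:E = \int[mu]_x (\1_A x * f x)%:E)%E.
Proof.
rewrite integral_mkcond epatch_indic; apply: eq_integral => x _ /=.
by rewrite -EFinM mulrC.
Qed.

(** * Change of measure *)

Section many_to_one.
Variables (R : realType) (dJ dW : measure_display).
Variables (J : measurableType dJ) (W : measurableType dW) (ev : R -> W -> J).
Variables (rate : J -> R) (p : R.-pker J ~> nat).
Variables (P : probability (F_infty_type ev) R).
Variables (Pt Qt : probability (Ft_infty_type ev) R).
Local Notation stree := (spined_tree ev).
Variables (zeta : R -> stree -> R) (zeta_ : R -> seq nat -> stree -> R).
Variable (t : R).
Hypothesis t0 : 0 <= t.
Hypothesis PtP : spine_law P Pt.
Hypothesis zeta_gt0 : forall s S, 0 <= s -> 0 < zeta s S.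
Hypothesis zetaG : forall s, 0 <= s -> meas_wrt (G_ (ev := ev) s) (zeta s).
Hypothesis zetaE : forall s, 0 <= s -> spine_decomposition s (zeta s) (zeta_ s).
Hypothesis zetatF : forall s, 0 <= s ->
  meas_wrt (Ft_ (ev := ev) s) (zetat rate p zeta s).
Hypothesis QtE : forall s A, 0 <= s -> Ft_ s A ->
  (Qt A = \int[Pt]_(S in A)
     (zetat rate p zeta s S / zetat rate p zeta 0 S)%:E)%E.

Lemma anc_prod_gt0 (T : marked_tree ev) u : 0 < anc_prod T u.
Proof. by apply: prodr_gt0 => k _; rewrite ltr0n. Qed.

Lemma zetat_gt0 s S : 0 <= s -> 0 < zetat rate p zeta s S.
Proof.
by move=> s0; rewrite !mulr_gt0 ?anc_prod_gt0 ?expR_gt0 ?zeta_gt0.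
Qed.

Lemma zetat0 S : zetat rate p zeta 0 S = zeta 0 S.
Proof.
have /alive0 n0 := alive_spine_node S (lexx 0).
rewrite /zetat n0 /anc_prod big_ord0 mul1r /discount.
by rewrite set_itv1 /Rintegral integral_set1 oppr0 expR0 mul1r.
Qed.

(** At time [0] every spine is at the root, so the normalising constant does not change when the
    spine is moved. *)
Lemma zetat0_mtree (S S' : stree) : mtree S = mtree S' ->
  zetat rate p zeta 0 S = zetat rate p zeta 0 S'.
Proof.
move=> SS'; have a0 (X : stree) : spine_node X 0 = [::].
  exact/alive0/alive_spine_node.
by apply: (meas_Ft_mtree (zetatF (lexx 0))) => //; rewrite !a0.
Qed.

Lemma meas_zetat0 : meas_wrt (F_ (ev := ev) t) (zetat rate p zeta 0).
Proof.
move=> B mB; rewrite (funext zetat0); apply: (G0_sub_F t0); exact: zetaG.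
Qed.

Definition weight u (S : stree) : R := discount rate p S u t * zeta_ t u S.

(** Where [u] is alive, [zeta_ t u] is the value of [zeta t] on a tree whose spine passes through
    [u]. *)
Lemma weight_gt0 (S : stree) u : alive S t u -> 0 < weight u S.
Proof.
move=> au; rewrite mulr_gt0 ?expR_gt0//.
rewrite (spine_decomposition_part t0 (zetaE t0) au).
by have [S' [_ _ ->]] := spine_partP (zeta t) au t0; exact: zeta_gt0.
Qed.

(** Isolates in the density the factor [anc_prod S u], which the division in [spine_law] cancels. *)
Lemma zetat_respine (S S' : stree) u : alive S t u -> mtree S' = mtree S ->
  spine_node S' t = u -> zetat rate p zeta t S' = anc_prod S u * weight u S.
Proof.
move=> au SS' S'u; rewrite /zetat S'u -mulrA /weight /discount SS'.
congr (_ * (_ * _)); have au' : alive S' t u by rewrite SS'.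
have [mz ->] := zetaE t0.
rewrite (sum_alive_node (fun v => zeta_ t v S'))// S'u.
exact: (meas_F_mtree (mz u)).
Qed.

Lemma meas_Qt (f : stree -> R) : meas_wrt (Ft_ (ev := ev) t) f ->
  measurable_fun (setT : set (Ft_infty_type ev)) (f : Ft_infty_type ev -> R).
Proof.
by move=> mf _ B mB; rewrite setTI; exact: (Ft_sub_Ft_infty t0 (mf _ mB)).
Qed.

Lemma meas_F_Ft (f : stree -> R) :
  meas_wrt (F_ (ev := ev) t) f -> meas_wrt (Ft_ (ev := ev) t) f.
Proof. by move=> mf B mB; apply: F_sub_Ft; exact: mf. Qed.

Definition alive_sum (f : stree -> R) (S : stree) : R :=
  \sum_(u \in alive S t) (spine_part t f u S * weight u S).

Lemma meas_alive_sum f : meas_wrt (Ft_ (ev := ev) t) f ->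
  meas_wrt (F_ (ev := ev) t) (alive_sum f).
Proof.
move=> mf.
(* Chosen so that its part at [u] is [f_u a_u]: the discount gets its measurability from that of
   [zetat]. *)
pose b S := f S * (zetat rate p zeta t S / anc_prod S (spine_node S t)).
have mb : meas_wrt (Ft_ (ev := ev) t) b.
  apply: meas_wrtM => //; apply: meas_wrt_div; first exact: zetatF.
    exact: meas_anc_prod_node.
  by move=> S; exact: anc_prod_gt0.
rewrite (_ : alive_sum f = fun S => \sum_(u \in alive S t) spine_part t b u S).
  by apply: meas_sum_alive => // u; exact: meas_spine_part.
apply/funext => S; apply: eq_fsbigr => u /[!inE] au.
have [S' [SS' S'u bE]] := spine_partP b au t0.
rewrite bE /b (zetat_respine au SS' S'u) S'u SS'.
rewrite mulrAC divff ?gt_eqF ?anc_prod_gt0// mul1r; congr (_ * _).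
have [S2 [SS2 S2u ->]] := spine_partP f au t0.
by apply: (meas_Ft_mtree mf); [rewrite SS2|rewrite S2u].
Qed.

Lemma integral_Qt (f : stree -> R) : meas_wrt (Ft_ (ev := ev) t) f ->
  (forall S, 0 <= f S) ->
  (\int[Qt]_S (f S)%:E =
   \int[P]_S (alive_sum f S / zetat rate p zeta 0 S)%:E)%E.
Proof.
move=> mf f0; pose D S := zetat rate p zeta t S / zetat rate p zeta 0 S.
have mD : meas_wrt (Ft_ (ev := ev) t) D.
  apply: meas_wrt_div; first exact: zetatF.
    exact: (meas_F_Ft meas_zetat0).
  by move=> S; exact: zetat_gt0.
have D0 S : 0 <= D S by rewrite ltW// divr_gt0 ?zetat_gt0.
have mfD : meas_wrt (Ft_ (ev := ev) t) (fun S => f S * D S) by exact: meas_wrtM.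
(* First from [Qt] to [Pt] by the density [D] on [Ft_ t], then from [Pt] to [P] by [spine_law]
   applied to [f * D]. *)
rewrite (@ge0_integral_density_sub _ (Ft_infty_type ev) _ Pt Qt _ _ _
  (Ft_sub_Ft_infty t0) mD D0 (fun A => @QtE t A t0) mf f0).
rewrite (PtP t0 mfD _ (spine_part_decomposition t0 mfD)); last first.
  by move=> S; rewrite mulr_ge0.
apply: eq_integral => S _; congr (_%:E).
rewrite /alive_sum mulr_fsuml; apply: eq_fsbigr => u /[!inE] au.
have [S' [SS' S'u ->]] := spine_partP (fun S => f S * D S) au t0.
have [S2 [SS2 S2u ->]] := spine_partP f au t0.
rewrite (meas_Ft_mtree mf (S' := S2)) ?SS2 ?S2u//.
rewrite /D (zetat_respine au SS' S'u) (zetat0_mtree SS').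
rewrite -!mulrA; congr (_ * _).
by rewrite mulrC -!mulrA mulVf ?mulr1// gt_eqF ?anc_prod_gt0.
Qed.

(** The spine node is alive, so this sum of positive terms is not empty. *)
Lemma Z_gt0 (S : stree) : 0 < Z_ rate p zeta_ t S.
Proof.
have an := alive_spine_node S t0.
rewrite /Z_ (fsbigD1 (spine_node S t))//=.
  rewrite ltr_pwDl//; first exact: weight_gt0 an.
  by apply: fsumr_ge0 => u [au _]; exact/ltW/weight_gt0.
by apply: sub_finite_set (finite_alive S t0) => u [].
Qed.

Lemma Z_E : Z_ rate p zeta_ t = alive_sum (cst 1).
Proof.
apply/funext => S; apply: eq_fsbigr => u /[!inE] au.
by have [S' [_ _ ->]] := spine_partP (cst 1) au t0; rewrite mul1r.
Qed.

Lemma meas_Z : meas_wrt (F_ (ev := ev) t) (Z_ rate p zeta_ t).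
Proof.
rewrite Z_E; apply: meas_alive_sum; apply/meas_wrtP; exact: measurable_cst.
Qed.

Definition weighted_sum (h : J -> R) (S : stree) : R :=
  \sum_(u \in alive S t) (h (pos S u t) * discount rate p S u t * zeta_ t u S).

Lemma weighted_sumE h :
  weighted_sum h = alive_sum (fun S => h (spine_pos S t)).
Proof.
apply/funext => S; apply: eq_fsbigr => u /[!inE] au.
have [S' [SS' S'u ->]] := spine_partP (fun S => h (spine_pos S t)) au t0.
by rewrite /spine_pos S'u SS' mulrA.
Qed.

Lemma meas_weighted_sum (h : J -> R) : measurable_fun setT h ->
  meas_wrt (F_ (ev := ev) t) (weighted_sum h).
Proof.
move=> mh; rewrite weighted_sumE; apply: meas_alive_sum.
exact: meas_spine_pos.
Qed.

(** Nonnegativity at spine positions is enough, because each particle alive is on the spine of a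
    tree with the same marks. *)
Lemma weighted_sum_ge0 h (S : stree) :
  (forall S : stree, 0 <= h (spine_pos S t)) ->
  0 <= weighted_sum h S.
Proof.
move=> h0; rewrite weighted_sumE; apply: fsumr_ge0 => u au.
rewrite mulr_ge0 ?(ltW (weight_gt0 au))//.
by have [S' [_ _ ->]] := spine_partP (fun S => h (spine_pos S t)) au t0.
Qed.

(** Moving the spine does not affect an [F_ t]-measurable factor, which can therefore be taken out
    of the sum. *)
Lemma alive_sum_F (f g : stree -> R) : meas_wrt (F_ (ev := ev) t) f ->
  alive_sum (fun S => f S * g S) = (fun S => f S * alive_sum g S).
Proof.
move=> mf; apply/funext => S; rewrite /alive_sum mulr_fsumr.
apply: eq_fsbigr => u /[!inE] au; rewrite [RHS]mulrA; congr (_ * _).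
rewrite /spine_part; case: pselect => // au'; congr (_ * _).
exact: (meas_F_mtree mf).
Qed.

Lemma meas_ratio (h : J -> R) : measurable_fun setT h ->
  meas_wrt (F_ (ev := ev) t) (fun S => weighted_sum h S / Z_ rate p zeta_ t S).
Proof.
move=> mh; apply: meas_wrt_div; first exact: meas_weighted_sum.
  exact: meas_Z.
exact: Z_gt0.
Qed.

Lemma integral_ratio (h : J -> R) A : measurable_fun setT h ->
  (forall S : stree, 0 <= h (spine_pos S t)) -> F_ (ev := ev) t A ->
  (\int[Qt]_(S in A) (weighted_sum h S / Z_ rate p zeta_ t S)%:E =
   \int[Qt]_(S in A) (h (spine_pos S t))%:E)%E.
Proof.
move=> mh h0 FA; have mr := meas_ratio mh.
have mA := @meas_wrt_indic _ _ R _ FA.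
rewrite [LHS]integral_indicM [RHS]integral_indicM !integral_Qt.
- apply: eq_integral => S _; congr (_ / _)%:E.
  rewrite [LHS](congr1 (@^~ S) (alive_sum_F _ mA)).
  rewrite [RHS](congr1 (@^~ S) (alive_sum_F _ mA)).
  congr (_ * _); rewrite -weighted_sumE.
  (* The factor [cst 1] exhibits the quotient as a multiple of the constant whose [alive_sum] is
     [Z]; the denominator then cancels. *)
  rewrite (_ : (fun S => _) =
    (fun S => weighted_sum h S / Z_ rate p zeta_ t S * cst 1 S)).
    by rewrite (alive_sum_F _ mr) -Z_E divfK// gt_eqF// Z_gt0.
  by apply/funext => S' /=; rewrite mulr1.
- by apply: meas_wrtM; [exact: meas_F_Ft|exact: meas_spine_pos].
- by move=> S; rewrite mulr_ge0// indicE ler0n.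
- by apply: meas_wrtM; exact: meas_F_Ft.
- move=> S; rewrite mulr_ge0 ?indicE ?ler0n// divr_ge0 ?weighted_sum_ge0//.
  exact/ltW/Z_gt0.
Qed.

Lemma weighted_sumB h (S : stree) :
  weighted_sum h S = weighted_sum h^\+ S - weighted_sum h^\- S.
Proof.
have fin := finite_alive S t0.
have hE y : h^\+ y = h y + h^\- y.
  by have /(congr1 (@^~ y)) /= <- := funrposBneg h; rewrite subrK.
apply/eqP; rewrite eq_sym subr_eq -fsbig_split//; apply/eqP/eq_fsbigr => u _ /=.
by rewrite hE !mulrDl.
Qed.

Lemma cond_exp_ratio (g : J -> R) : measurable_fun setT g ->
  (forall S : stree, 0 <= g (spine_pos S t)) \/
    Qt.-integrable setT (fun S => (g (spine_pos S t))%:E) ->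
  is_cond_exp Qt (F_ (ev := ev) t) (fun S => (g (spine_pos S t))%:E)
    (fun S => (weighted_sum g S / Z_ rate p zeta_ t S)%:E).
Proof.
move=> mg g0I; split.
  apply/meas_wrtP/measurable_EFinP.
  exact: (proj1 (meas_wrtP _ _) (meas_ratio mg)).
move=> A FA; case: g0I => [g0|ig]; first exact: integral_ratio.
have mA : measurable (A : set (Ft_infty_type ev)).
  exact: (Ft_sub_Ft_infty t0 (F_sub_Ft FA)).
have mpos : measurable_fun setT g^\+ by exact: measurable_funrpos.
have mneg : measurable_fun setT g^\- by exact: measurable_funrneg.
have ipos : Qt.-integrable setT (fun S => (g^\+ (spine_pos S t))%:E).
  exact: (integrable_funrpos measurableT ig).
have ineg : Qt.-integrable setT (fun S => (g^\- (spine_pos S t))%:E).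
  exact: (integrable_funrneg measurableT ig).
have FT : F_ (ev := ev) t setT.
  exact: (@measurableT _ (g_sigma_algebraType _)).
(* The quotients of [g^\+] and [g^\-] must be integrable before they are subtracted;
   [integral_ratio] on the whole space gives this. *)
have iratio (h : J -> R) : measurable_fun setT h -> (forall y, 0 <= h y) ->
    Qt.-integrable setT (fun S => (h (spine_pos S t))%:E) ->
    Qt.-integrable A (fun S => (weighted_sum h S / Z_ rate p zeta_ t S)%:E).
  move=> mh h0 /integrableP[_ ih].
  have r0 S : 0 <= weighted_sum h S / Z_ rate p zeta_ t S.
    by apply: divr_ge0; [exact: weighted_sum_ge0|exact/ltW/Z_gt0].
  apply: (@integrableS _ _ _ _ setT) => //; apply/integrableP; split.
    apply/measurable_EFinP; exact: (meas_Qt (meas_F_Ft (meas_ratio mh))).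
  under eq_integral do rewrite gee0_abs ?lee_fin//.
  rewrite integral_ratio//.
  by under eq_integral do rewrite -[_%:E]gee0_abs ?lee_fin//.
under eq_integral do rewrite weighted_sumB mulrBl EFinB.
rewrite integralB_EFin//; [|exact: iratio|exact: iratio].
rewrite !integral_ratio// -integralB_EFin//; last 2 first.
- exact: integrableS ipos.
- exact: integrableS ineg.
apply: eq_integral => S _; rewrite -EFinB; congr (_%:E).
by rewrite -[in RHS](funrposBneg g).
Qed.

End many_to_one.

Theorem corollary8p3 (R : realType) (dJ dW : measure_display)
    (J : measurableType dJ) (W : measurableType dW) (ev : R -> W -> J)
    (Xi : R.-pker J ~> W) (rate : J -> R) (p : R.-pker J ~> nat) (x : J)
    (P : probability (F_infty_type ev) R)
    (Pt Qt : probability (Ft_infty_type ev) R)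
    (zeta : R -> spined_tree ev -> R)
    (zeta_ : R -> seq nat -> spined_tree ev -> R)
    (g : J -> R) (t : R) :
  markov_process ev Xi ->
  measurable_fun setT rate ->
  (forall y, 0 <= rate y) ->
  (forall y, (mean_offspring_ext p y < +oo)%E) ->
  branching_law Xi rate p P x ->
  spine_law P Pt ->
  (forall s S, 0 <= s -> 0 < zeta s S) ->
  martingale Pt (G_ (ev := ev)) zeta ->
  (forall s, 0 <= s -> spine_decomposition s (zeta s) (zeta_ s)) ->
  (forall (S : spined_tree ev) s u, 0 <= s -> alive S s u ->
     lebesgue_measure.-integrable `[0, s]
       (fun r => (mR rate p (pos S u r))%:E)) ->
  martingale Pt (Ft_ (ev := ev)) (zetat rate p zeta) ->
  (forall s A, 0 <= s -> Ft_ s A ->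
     (Qt A = \int[Pt]_(S in A)
               (zetat rate p zeta s S / zetat rate p zeta 0 S)%:E)%E) ->
  measurable_fun setT g ->
  0 <= t ->
  (forall S : spined_tree ev, 0 <= g (spine_pos S t)) \/
    Qt.-integrable setT (fun S => (g (spine_pos S t))%:E) ->
  (exists Y, is_cond_exp Qt (F_ t) (fun S => (g (spine_pos S t))%:E) Y) /\
  (forall Y, is_cond_exp Qt (F_ t) (fun S => (g (spine_pos S t))%:E) Y ->
     {ae Qt, forall S : spined_tree ev,
       (\sum_(u \in alive S t)
          (g (pos S u t) * discount rate p S u t * zeta_ t u S))%:E
       = (Y S * (Z_ rate p zeta_ t S)%:E)%E}).
Proof.
move=> _ _ _ _ _ PtP z0 [zG _ _] zE _ [ztF _ _] QtE mg t0 g0I.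
have ce := cond_exp_ratio t0 PtP z0 zG zE ztF QtE mg g0I.
split=> [|Y cY]; first by eexists; exact: ce.
have sub : F_ (ev := ev) t `<=` @measurable _ (Ft_infty_type ev).
  by move=> A FA; exact: (Ft_sub_Ft_infty t0 (F_sub_Ft FA)).
(* Every version [Y] agrees almost everywhere with the finite version [N / Z], and [Z] is
   positive. *)
have := @is_cond_exp_unique _ (Ft_infty_type ev) _ Qt _ _ _ _ sub ce cY.
apply: filterS => S <-.
by rewrite -EFinM divfK// gt_eqF// (Z_gt0 _ _ t0 z0 zE).
Qed.
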